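(* Let $B=\{a_1<\dots<a_r\}$ be a totally ordered alphabet and $n\ge1$. The $K$-linear map $f:W_n^r\to P_n^r$ with $f(w)=\{w\}$ for each word $w$ is an isomorphism of left $K\mathfrak S_n$-modules, where $\mathfrak S_n$ acts on $W_n^r$ on the left by $\sigma\circ P=P\cdot\sigma^{-1}$; i.e. $f(P\cdot\sigma^{-1})=\sigma\cdot f(P)$ for all $\sigma\in\mathfrak S_n$ and $P\in W_n^r$. Its restriction to $W_n^\lambda$ is an isomorphism onto $T_n^\lambda$ for every partition $\lambda$ of $n$ with $r$ parts. Moreover, for every word $w$ of length $n$ with $alph(w)=B$, \[ f(w\cdot l_n^* )=l_n\cdot\{w\}. \]
   Context: $K$ is a commutative ring with unity, $[n]=\{1,\dots,n\}$, $\mathfrak S_n$ the symmetric group with product $\sigma\tau=\sigma\circ\tau$. $\mathfrak S_n$ acts on the right on words of length $n$ by place permutation $(y_1\cdots y_n)\cdot\sigma=y_{\sigma(1)}\cdots y_{\sigma(n)}$, extended linearly to $K\mathfrak S_n$ and to polynomials. $W_n^r$ is the $K$-span of the words $w$ of length $n$ with $alph(w)=B$ (set of occurring letters equal to $B$); for $\lambda=(\lambda_1,\dots,\lambda_r)$, $W_n^\lambda$ is the $K$-span of words with exactly $\lambda_k$ occurrences of $a_k$ for each $k$. $P_n^r$ is the free $K$-module on ordered set partitions $(I_1,\dots,I_r)$ of $[n]$ into $r$ nonempty blocks, and $T_n^\lambda$ the submodule spanned by those with $|I_k|=\lambda_k$ ($\lambda$-tabloids); $\mathfrak S_n$ acts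 on the left by $\sigma\cdot(I_1,\dots,I_r)=(\sigma(I_1),\dots,\sigma(I_r))$, extended linearly. For $w=y_1\cdots y_n$ with $alph(w)=B$, $\{w\}=(I_1(w),\dots,I_r(w))$ with $I_k(w)=\{i: y_i=a_k\}$. The left normed Lie bracketing is $l(a)=a$, $l(ua)=l(u)a-a\,l(u)$, and $l^*$ its adjoint with respect to the scalar product making words orthonormal, i.e. $(l^*(u),v)=(l(v),u)$ for all words. For distinct letters $x_1,\dots,x_n$, $l_n,l_n^*\in K\mathfrak S_n$ are defined by $(x_1\cdots x_n)\cdot l_n=l(x_1\cdots x_n)$ and $(x_1\cdots x_n)\cdot l_n^*=l^*(x_1\cdots x_n)$. *)

(* Defs.v *)
From HB Require Import structures.
From mathcomp Require Import all_boot all_order all_fingroup all_algebra.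
From mathcomp Require Import finmap.
From mathcomp Require Export monalg.

Set Implicit Arguments.
Unset Strict Implicit.
Unset Printing Implicit Defensive.

Import GRing.Theory.
Local Open Scope ring_scope.

(* {malg K[X]} is the free K-module on X, << x >> is the basis element attached
   to x, and P@_x is the coefficient of x in P.  {malg K[{fmonom X}]} is the
   algebra of noncommutative polynomials K<X>.                                *)

Definition Kspan (K : comNzRingType) (X : choiceType) (S : pred X)
    (P : {malg K[X]}) : Prop :=
  exists (s : seq X) (c : X -> K),
    all S s /\ P = \sum_(x <- s) c x *: << x >>.

Section Words.
Variables (K : comNzRingType) (X : finType).
Implicit Types (u v : seq X) (P Q : {malg K[{fmonom X}]}).

Definition wordp u : {malg K[{fmonom X}]} := << FMonom u >>.

Definition alph u : {set X} := [set a in u].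

Definition dotp P Q : K := \sum_(w <- msupp P) P@_w * Q@_w.

(* The value on the empty word is a convention. *)
Definition lie u : {malg K[{fmonom X}]} :=
  if u is a :: u' then
    foldl (fun P b => P * wordp [:: b] - wordp [:: b] * P) (wordp [:: a]) u'
  else 0.

(* The sum over words of length |u| suffices, as lie v is homogeneous of degree
   |v|; see lie_adjP. *)
Definition lie_adj u : {malg K[{fmonom X}]} :=
  \sum_(v : (size u).-tuple X) (lie v)@_(FMonom u) *: wordp v.

Definition place n (w : n.-tuple X) (s : 'S_n) : n.-tuple X :=
  [tuple tnth w (s i) | i < n].

(* P . s for P homogeneous of degree n; components of other degrees, on which
   'S_n does not act, are dropped. *)
Definition polyact n P (s : 'S_n) : {malg K[{fmonom X}]} :=
  \sum_(w : n.-tuple X) P@_(FMonom w) *: wordp (place w s).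

(* The linear extension of the above to the group algebra, whose elements are
   taken in the free module on 'S_n. *)
Definition polyactK n P (c : {malg K['S_n]}) : {malg K[{fmonom X}]} :=
  \sum_(s : 'S_n) c@_s *: polyact P s.

Definition circ n (s : 'S_n) P : {malg K[{fmonom X}]} := polyact P s^-1%g.

Definition circK n (c : {malg K['S_n]}) P : {malg K[{fmonom X}]} :=
  \sum_(s : 'S_n) c@_s *: circ s P.

End Words.

Arguments lie {K X} u.
Arguments lie_adj {K X} u.
Arguments wordp K {X} u.

(* l_n and l_n^*, computed with the distinct letters x_1, ..., x_n taken to be
   the elements of 'I_n in order; they satisfy the defining identities for any
   distinct letters, see lie_eltP and lie_adj_eltP. *)
Definition lie_elt (K : comNzRingType) n : {malg K['S_n]} :=
  \sum_(s : 'S_n) (lie (ord_tuple n))@_(FMonom (place (ord_tuple n) s))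
    *: << s >>.

Definition lie_adj_elt (K : comNzRingType) n : {malg K['S_n]} :=
  \sum_(s : 'S_n) (lie_adj (ord_tuple n))@_(FMonom (place (ord_tuple n) s))
    *: << s >>.

Definition is_osp n r (I : {ffun 'I_r -> {set 'I_n}}) : bool :=
  injectiveb I && partition [set I k | k : 'I_r] [set: 'I_n].

Record osp n r := Osp {osp_val :> {ffun 'I_r -> {set 'I_n}}; _ : is_osp osp_val}.

HB.instance Definition _ n r := [isSub for @osp_val n r].
HB.instance Definition _ n r := [Finite of osp n r by <:].

Lemma osp_actP n r (s : 'S_n) (I : osp n r) :
  is_osp [ffun k => s @: I k].
Proof.
case: I => I /= /andP[/injectiveP injI partI].
have injs : injective (fun A : {set 'I_n} => s @: A) by exact/imset_inj/perm_inj.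
have E : [set [ffun k => s @: I k] k | k : 'I_r]
         = [set s @: A | A : {set 'I_n} in [set I k | k : 'I_r]].
  rewrite -imset_comp; apply: eq_imset => k /=; by rewrite ffunE.
apply/andP; split.
  by apply/injectiveP => k l; rewrite !ffunE => /injs /injI.
rewrite E; case/and3P: partI => /eqP cov tri n0.
apply/and3P; split.
- rewrite /cover; apply/eqP/setP => i; rewrite inE; apply/bigcupP.
  have : (s^-1)%g i \in cover [set I k | k : 'I_r] by rewrite cov inE.
  case/bigcupP => A AI iA; exists (s @: A); first exact: imset_f.
  by apply/imsetP; exists ((s^-1)%g i); rewrite // permKV.
- apply/trivIsetP => _ _ /imsetP[A AI ->] /imsetP[C CI ->] neq.
  rewrite -setI_eq0 -imsetI; last by move=> ? ? _ _; exact: perm_inj.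
  have /trivIsetP/(_ A C AI CI) := tri.
  rewrite -setI_eq0 imset_eq0; apply.
  by apply: contraNneq neq => ->.
- apply/imsetP => -[A AI /esym/eqP]; rewrite imset_eq0 => /eqP A0.
  by rewrite A0 in AI; rewrite AI in n0.
Qed.

Definition osp_act n r (s : 'S_n) (I : osp n r) : osp n r := Osp (osp_actP s I).

Section Tabloids.
Variables (K : comNzRingType) (n r : nat).
Implicit Types (T : {malg K[osp n r]}).

Definition tabact (s : 'S_n) T : {malg K[osp n r]} :=
  \sum_(I : osp n r) T@_I *: << osp_act s I >>.

Definition tabactK (c : {malg K['S_n]}) T : {malg K[osp n r]} :=
  \sum_(s : 'S_n) c@_s *: tabact s T.

Definition in_Tlambda (lam : r.-tuple nat) : {malg K[osp n r]} -> Prop :=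
  Kspan [pred I : osp n r | [forall k, #|I k| == tnth lam k]].

End Tabloids.

Section WordTabloid.
Variables (K : comNzRingType) (d : Order.disp_t) (B : finOrderType d) (n : nat).

Local Notation r := #|B|.

(* letter k is the (k+1)-st smallest element of B *)
Definition letter (k : 'I_r) : B := Order.enum_val k.

Definition in_W : {malg K[{fmonom B}]} -> Prop :=
  Kspan [pred w : {fmonom B} | (size w == n) && (alph w == [set: B])].

Definition in_Wlambda (lam : r.-tuple nat) : {malg K[{fmonom B}]} -> Prop :=
  Kspan [pred w : {fmonom B} | [forall k, count_mem (letter k) w == tnth lam k]].

Definition full_word := {w : n.-tuple B | alph w == [set: B]}.

Definition blocks (w : n.-tuple B) : {ffun 'I_r -> {set 'I_n}} :=
  [ffun k => [set i | tnth w i == letter k]].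

Lemma blocksP (w : full_word) : is_osp (blocks (val w)).
Proof.
case: w => w /= /eqP/setP full.
have ex k : exists i, tnth w i = letter k.
  have := full (letter k); rewrite !inE => /tnthP[i e]; by exists i.
have mem i k : (i \in blocks w k) = (tnth w i == letter k) by rewrite ffunE inE.
apply/andP; split.
  apply/injectiveP => k l e; have [i ei] := ex k.
  have := mem i l; rewrite -e mem ei eqxx => /esym/eqP.
  exact: Order.enum_val_inj.
apply/and3P; split.
- apply/eqP/setP => i; rewrite inE; apply/bigcupP.
  exists (blocks w (Order.enum_rank (tnth w i))); first exact: imset_f.
  by rewrite mem /letter Order.enum_rankK.
- apply/trivIsetP => _ _ /imsetP[k _ ->] /imsetP[l _ ->] neq.
  rewrite -setI_eq0; apply/eqP/setP => i; rewrite !inE !mem.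
  apply/negP => /andP[/eqP-> /eqP/Order.enum_val_inj e].
  by rewrite e eqxx in neq.
- apply/imsetP => -[k _ /setP e]; have [i ei] := ex k.
  by have := e i; rewrite mem ei eqxx inE.
Qed.

Definition tabloid (w : full_word) : osp n r := Osp (blocksP w).

(* The map f; words not in W_n^r are sent to 0. *)
Definition tabloid_map (P : {malg K[{fmonom B}]}) : {malg K[osp n r]} :=
  \sum_(w : full_word) P@_(FMonom (val w)) *: << tabloid w >>.

End WordTabloid.

(* f restricts to an isomorphism of left modules over the group algebra of 'S_n
   from the submodule M of U onto the submodule N of V. *)
Record module_iso_on (K : comNzRingType) (n : nat) (U V : lmodType K)
    (actU : {malg K['S_n]} -> U -> U) (actV : {malg K['S_n]} -> V -> V)
    (M : U -> Prop) (N : V -> Prop) (f : U -> V) : Prop := ModuleIsoOn {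
  iso_stable_dom : forall c x, M x -> M (actU c x);
  iso_stable_codom : forall c y, N y -> N (actV c y);
  iso_linear : forall a x y, M x -> M y -> f (a *: x + y) = a *: f x + f y;
  iso_maps : forall x, M x -> N (f x);
  iso_inj : forall x y, M x -> M y -> f x = f y -> x = y;
  iso_surj : forall y, N y -> exists2 x, M x & f x = y;
  iso_equiv : forall c x, M x -> f (actU c x) = actV c (f x)
}.

Definition is_partition (n r : nat) (lam : r.-tuple nat) : bool :=
  [&& sorted geq lam, all (ltn 0) lam & sumn lam == n].

Section Checks.
Variables (K : comNzRingType) (X : finType).
Implicit Types (u v : seq X) (P Q : {malg K[{fmonom X}]}).

Lemma lie1 (a : X) : lie [:: a] = wordp K [:: a].
Proof. by []. Qed.

Lemma lie_rcons u (a : X) : u != [::] ->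
  lie (rcons u a) = lie u * wordp K [:: a] - wordp K [:: a] * lie u.
Proof. by case: u => // b u _; rewrite /= -cats1 foldl_cat. Qed.

Lemma dotp_wordp P v : dotp P (wordp K v) = P@_(FMonom v).
Proof.
rewrite [in RHS](monalgE P) raddf_sum; apply: eq_bigr => w _ /=.
by rewrite !mcoeffU eq_sym; case: eqP => _; rewrite ?mulr1 ?mulr0.
Qed.

Lemma supp_lie u v : (lie u)@_(FMonom v) != 0 :> K -> perm_eq v u.
Proof.
elim/last_ind: u v => [|u a IH] v; first by rewrite mcoeff0 eqxx.
have [->|u0] := eqVneq u [::].
  rewrite lie1 mcoeffU; case: (FMonom _ =P _) => [[<-] //|_]; by rewrite eqxx.
rewrite lie_rcons // mcoeff_neq0 => /(fsubsetP (msuppB_le _ _)).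
rewrite in_fsetU => /orP[] /msuppM_le[[p] [[q] [hp hq e]]].
- move: hq; rewrite msuppU oner_eq0 in_fset1 => /eqP[eq].
  move/(congr1 (@fmonom_val X)): e; rewrite fmM /= eq => ->.
  by rewrite -cats1 perm_cat2r; apply: IH; rewrite mcoeff_neq0.
- move: hp; rewrite msuppU oner_eq0 in_fset1 => /eqP[ep].
  move/(congr1 (@fmonom_val X)): e; rewrite fmM /= ep => ->.
  by rewrite perm_sym perm_rcons perm_cons perm_sym; apply: IH; rewrite mcoeff_neq0.
Qed.

Lemma mcoeff_sumU (I : finType) (Z : choiceType) (g : I -> K) (e : I -> Z) z :
  (\sum_i g i *: << e i >>)@_z = \sum_(i | e i == z) g i.
Proof.
rewrite raddf_sum [RHS]big_mkcond; apply: eq_bigr => i _ /=.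
by rewrite mcoeffZ mcoeffU; case: eqP => _; rewrite ?mulr1 ?mulr0.
Qed.

Lemma mcoeff_lie_adj u v : (lie_adj u)@_(FMonom v) = (lie v)@_(FMonom u) :> K.
Proof.
rewrite /lie_adj mcoeff_sumU; have [e|ne] := eqVneq (size v) (size u).
  rewrite (big_pred1 (tcast e (in_tuple v))) => [|w].
    by have -> : tval (tcast e (in_tuple v)) = v by case: _ / e.
  rewrite -[LHS]val_eqE -[RHS]val_eqE /=.
  by have -> : tval (tcast e (in_tuple v)) = v by case: _ / e.
rewrite big_pred0 => [|w].
  apply/esym/eqP; have [//|/supp_lie/perm_size e] := eqVneq.
  by rewrite e eqxx in ne.
by apply: contraNF ne => /eqP[<-]; rewrite size_tuple.
Qed.

Lemma lie_adjP u v :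
  dotp (lie_adj u) (wordp K v) = dotp (lie v) (wordp K u).
Proof. by rewrite !dotp_wordp mcoeff_lie_adj. Qed.

Lemma placeM n (w : n.-tuple X) (s t : 'S_n) :
  place (place w s) t = place w (t * s)%g.
Proof. by apply: eq_from_tnth => i; rewrite !tnth_mktuple permM. Qed.

Lemma polyact_word n (w : n.-tuple X) (s : 'S_n) :
  polyact (wordp K w) s = wordp K (place w s).
Proof.
rewrite /polyact (bigD1 w) //= mcoeffU eqxx scale1r big1 ?addr0 // => v neq.
rewrite mcoeffU; case: eqP => [[e]|_]; last by rewrite scale0r.
by case/eqP: neq; apply: val_inj.
Qed.

End Checks.

Lemma osp_actM n r (s t : 'S_n) (I : osp n r) :
  osp_act s (osp_act t I) = osp_act (t * s)%g I.
Proof.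
apply/val_inj/ffunP => k; rewrite !ffunE -imset_comp.
by apply: eq_imset => i /=; rewrite permM.
Qed.

Lemma tabloid_map_word (K : comNzRingType) d (B : finOrderType d) n
    (w : full_word B n) :
  tabloid_map n (wordp K (val w)) = << tabloid w >>.
Proof.
rewrite /tabloid_map (bigD1 w) //= mcoeffU eqxx scale1r big1 ?addr0 // => v neq.
rewrite mcoeffU; case: eqP => [[e]|_]; last by rewrite scale0r.
by case/eqP: neq; do 2!apply: val_inj.
Qed.

Section Naturality.
Variables (K : comNzRingType) (X Y : finType) (h : X -> Y).
Hypothesis injh : injective h.

Lemma mcoeff_mulUr (Z : finType) (P : {malg K[{fmonom Z}]}) a v :
  (P * wordp K [:: a])@_(FMonom (v : seq Z)) =
    if v is b :: v' then
      if last b v' == a then P@_(FMonom (belast b v')) else 0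
    else 0.
Proof.
rewrite [P in LHS]monalgE mulr_suml raddf_sum /=.
under eq_bigr => w _ do rewrite malgM_def fgmulUU mulr1 mcoeffU -val_eqE /= fmM /=.
case: v => [|b v].
  by rewrite big1 // => w _; case: (w : seq Z).
rewrite (lastI b v); case: (last b v =P a) => [->|ne].
  rewrite [P in RHS]monalgE raddf_sum; apply: eq_bigr => w _ /=.
  by rewrite mcoeffU -val_eqE /= cats1 eqseq_rcons eqxx andbT.
rewrite big1 // => w _; rewrite cats1 eqseq_rcons andbC [a == _]eq_sym.
by case: (last b v =P a).
Qed.

Lemma mcoeff_mulUl (Z : finType) (P : {malg K[{fmonom Z}]}) a v :
  (wordp K [:: a] * P)@_(FMonom (v : seq Z)) =
    if v is b :: v' then if b == a then P@_(FMonom v') else 0 else 0.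
Proof.
rewrite [P in LHS]monalgE mulr_sumr raddf_sum /=.
under eq_bigr => w _ do rewrite malgM_def fgmulUU mul1r mcoeffU -val_eqE /= fmM /=.
case: v => [|b v]; first by rewrite big1 // => w _.
case: (b =P a) => [->|ne].
  rewrite [P in RHS]monalgE raddf_sum; apply: eq_bigr => w _ /=.
  by rewrite mcoeffU -val_eqE /= eqseq_cons eqxx.
by rewrite big1 // => w _; rewrite eqseq_cons [a == b]eq_sym; case: (b =P a).
Qed.

Lemma mcoeff_bracket (Z : finType) (P : {malg K[{fmonom Z}]}) a v :
  (P * wordp K [:: a] - wordp K [:: a] * P)@_(FMonom (v : seq Z)) =
    if v is b :: v' then
      (if last b v' == a then P@_(FMonom (belast b v')) else 0)
        - (if b == a then P@_(FMonom v') else 0)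
    else 0.
Proof.
etransitivity; first exact: mcoeffB.
have := congr2 (fun y z => y - z) (mcoeff_mulUr P a v) (mcoeff_mulUl P a v).
by move=> ->; case: v => //; rewrite subr0.
Qed.

Lemma mcoeff_lie_map u v :
  (lie (map h u))@_(FMonom (map h v)) = (lie u)@_(FMonom v) :> K.
Proof.
elim/last_ind: u v => [|u a IH] v; first by rewrite !mcoeff0.
have [->|u0] := eqVneq u [::].
  rewrite !mcoeffU -!val_eqE /= -[[:: h a]]/(map h [:: a]).
  by rewrite (inj_eq (inj_map injh)).
rewrite map_rcons !lie_rcons //; last by case: (u) u0.
rewrite !mcoeff_bracket; case: v => [//|b v].
by rewrite map_cons; cbv iota; rewrite last_map !(inj_eq injh) belast_map !IH.
Qed.

End Naturality.

Section DefiningIdentities.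
Variables (K : comNzRingType) (X : finType) (n : nat) (x : n.-tuple X).
Hypothesis x_uniq : uniq x.

Let tnth_x_inj : injective (tnth x).
Proof. by apply/tuple_uniqP. Qed.

Let place_x s : place x s = map (tnth x) (place (ord_tuple n) s) :> seq X.
Proof. 
rewrite -map_comp; apply: eq_map => i /=; by rewrite tnth_ord_tuple.
Qed.

Let x_map : x = map (tnth x) (ord_tuple n) :> seq X.
Proof. by rewrite map_tnth_enum. Qed.

Let expand (Q : {malg K[{fmonom X}]}) (c : {malg K['S_n]}) :
    (forall v, Q@_(FMonom v) != 0 -> perm_eq v x) ->
    (forall s, c@_s = Q@_(FMonom (place x s))) ->
  polyactK (wordp K x) c = Q.
Proof.
move=> suppQ cE; apply/malgP => -[v].
rewrite /polyactK; under eq_bigr => s _ do rewrite polyact_word cE.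
rewrite mcoeff_sumU; have [p|np] := boolP (perm_eq v x).
  have sz : size v == n by rewrite (perm_size p) size_tuple.
  have /tuple_permP[s e] : perm_eq (Tuple sz) x by [].
  have -> : v = place x s by rewrite -e.
  rewrite (big_pred1 s) // => t; apply/eqP/eqP => [|->//].
  move/(congr1 (@fmonom_val X)) => e1; apply/permP => i.
  have e2 : place x t = place x s by exact: val_inj.
  apply: tnth_x_inj.
  by have := congr1 (fun w => tnth w i) e2; rewrite !tnth_mktuple.
have Q0 : Q@_(FMonom v) = 0.
  by apply/eqP; have [//|/suppQ p] := eqVneq; rewrite p in np.
by rewrite Q0 big1 // => s /eqP ->.
Qed.

Let coefE (g : 'S_n -> K) s : (\sum_t g t *: << t >>)@_s = g s.
Proof.
by rewrite mcoeff_sumU (big_pred1 s).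
Qed.

Lemma lie_eltP : polyactK (wordp K x) (lie_elt K n) = lie x.
Proof.
apply: expand => [v|s]; first exact: supp_lie.
by rewrite coefE place_x [in RHS]x_map mcoeff_lie_map.
Qed.

Lemma lie_adj_eltP : polyactK (wordp K x) (lie_adj_elt K n) = lie_adj x.
Proof.
apply: expand => [v|s].
  by rewrite mcoeff_lie_adj => /supp_lie; rewrite perm_sym.
by rewrite coefE !mcoeff_lie_adj place_x [in RHS]x_map mcoeff_lie_map.
Qed.

End DefiningIdentities.

(* Main.v *)
Require Import Defs.
From HB Require Import structures.
From mathcomp Require Import all_boot all_order all_fingroup all_algebra.
From mathcomp Require Import finmap.
Local Open Scope ring_scope.
Import GRing.Theory.

Set Implicit Arguments.
Unset Strict Implicit.
Unset Printing Implicit Defensive.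

(** All three claims are read off coefficients: [w |-> {w}] is a bijection from
    the words of length [n] using every letter of [B] onto the ordered set
    partitions, so [f P] has at [{w}] the coefficient of [P] at [w], and the
    blocks of [w . s^-1] are the images under [s] of the blocks of [w].  The
    identity [f (w . l_n^* ) = l_n . {w}] then reduces to the fact that the
    coefficient of [l_n^*] at [s] is that of [l_n] at [s^-1], which follows
    from adjointness by renaming letters along [s^-1]. *)

(** * Spans of basis elements, via supports *)

(** Makes membership in a span a condition on the support. For the converse, the spanning list is
    the support of [P] with its own coefficients. *)
Lemma KspanP (K : comNzRingType) (X : choiceType) (S : pred X)
    (P : {malg K[X]}) :
  Kspan S P <-> (forall x, P@_x != 0 -> S x).
Proof.
split=> [[s [c [/allP Ss ->]]] x|SP].
  rewrite raddf_sum /= => nz; apply: contraNT nz => nSx.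
  rewrite big_seq big1 // => y /Ss Sy.
  rewrite mcoeffZ mcoeffU; case: eqP => [e|_]; last by rewrite mulr0.
  by rewrite -e Sy in nSx.
exists (msupp P), (fun x => P@_x); split.
  by apply/allP => x; rewrite -mcoeff_neq0 => /SP.
rewrite [LHS]monalgE; apply: eq_bigr => x _.
by apply/malgP => y; rewrite mcoeffZ !mcoeffU mulr_natr.
Qed.

Lemma mcoeff_sum_neq0 (K : comNzRingType) (X : choiceType) (I : finType)
    (c : I -> K) (P : I -> {malg K[X]}) (x : X) :
  (\sum_i c i *: P i)@_x != 0 -> exists i, (P i)@_x != 0.
Proof.
move=> nz; apply/existsP; apply: contraNT nz => /existsPn P0.
rewrite raddf_sum big1 // => i _ /=.
by have := P0 i; rewrite negbK mcoeffZ => /eqP ->; rewrite mulr0.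
Qed.

(** * Place permutation of words and polynomials *)

Section Place.
Variables (K : comNzRingType) (X : finType) (n : nat).
Implicit Types (w : n.-tuple X) (s : 'S_n) (P : {malg K[{fmonom X}]}).

Lemma place1 w : place w 1%g = w.
Proof. by apply: eq_from_tnth => i; rewrite tnth_mktuple perm1. Qed.

Lemma placeK s : cancel (fun w => place w s) (fun w => place w s^-1%g).
Proof. by move=> w; rewrite placeM mulVg place1. Qed.

Lemma perm_place w s : perm_eq (place w s) w.
Proof. by apply/tuple_permP; exists s. Qed.

Lemma mcoeff_polyact P s w :
  (polyact P s)@_(FMonom w) = P@_(FMonom (place w s^-1%g)).
Proof.
rewrite mcoeff_sumU (big_pred1 (place w s^-1%g)) // => v.
apply/eqP/eqP => [[e]|->]; last by rewrite placeM mulgV place1.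
have <- : place v s = w by apply: val_inj.
by rewrite placeK.
Qed.

(** Since [polyact] drops all degrees other than [n], only words of length [n] can survive in its
    support. *)
Lemma polyact_neq0 P s (u : {fmonom X}) : (polyact P s)@_u != 0 ->
  exists2 w : n.-tuple X, u = FMonom w & P@_(FMonom (place w s^-1%g)) != 0.
Proof.
move=> nz; have [w] := mcoeff_sum_neq0 nz.
rewrite mcoeffU; case: (_ =P u) => [e _|_]; last by rewrite eqxx.
by exists (place w s); rewrite -?mcoeff_polyact // e.
Qed.

(** Place permutation only rearranges the letters of a word, so any condition depending on letter
    multiplicities alone is preserved on supports. *)
Lemma circK_stable (S : pred {fmonom X}) (c : {malg K['S_n]}) P :
  (forall u v : {fmonom X}, perm_eq u v -> S u -> S v) ->
  Kspan S P -> Kspan S (circK c P).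
Proof.
move=> S_perm /KspanP SP; apply/KspanP => u.
case/mcoeff_sum_neq0 => s /polyact_neq0[w -> /SP].
by apply: S_perm; apply: perm_place.
Qed.

End Place.

(** * The left action on ordered set partitions *)

Section OspAction.
Variables (K : comNzRingType) (n r : nat).
Implicit Types (I : osp n r) (s : 'S_n) (T : {malg K[osp n r]}).

Lemma osp_act1 I : osp_act 1%g I = I.
Proof.
apply/val_inj/ffunP => k; rewrite ffunE -[RHS]imset_id.
by apply: eq_imset => i; rewrite perm1.
Qed.

Lemma osp_actK s : cancel (@osp_act n r s) (osp_act s^-1%g).
Proof. by move=> I; rewrite osp_actM mulgV osp_act1. Qed.

Lemma mcoeff_tabact T s I : (tabact s T)@_I = T@_(osp_act s^-1%g I).
Proof.
rewrite mcoeff_sumU (big_pred1 (osp_act s^-1%g I)) // => J.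
by apply/eqP/eqP => [<-|->]; rewrite ?osp_actK // osp_actM mulVg osp_act1.
Qed.

End OspAction.

(** * Words using every letter correspond to ordered set partitions *)

Section Tabloid.
Variables (K : comNzRingType) (d : Order.disp_t) (B : finOrderType d) (n : nat).
Implicit Types (w : full_word B n) (s : 'S_n) (P : {malg K[{fmonom B}]}).
Implicit Types (I : osp n #|B|) (T : {malg K[osp n #|B|]}).

Lemma mem_tabloid w i k :
  (i \in tabloid w k) = (tnth (val w) i == letter k).
Proof. by rewrite /= ffunE inE. Qed.

Lemma letter_rank (b : B) : letter (Order.enum_rank b) = b.
Proof. exact: Order.enum_rankK. Qed.

Lemma letter_inj : injective (@letter d B).
Proof. exact: Order.enum_val_inj. Qed.

Lemma tabloid_inj : injective (@tabloid d B n).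
Proof.
move=> v w e; apply/val_inj/eq_from_tnth => i; apply/eqP.
by rewrite -[tnth (val w) i]letter_rank -mem_tabloid e mem_tabloid letter_rank.
Qed.

(** The preimage carries at position [i] the letter indexing the block that contains [i]; covering
    makes it defined, and nonempty blocks make every letter occur. *)
Lemma tabloid_surj I : exists w, tabloid w = I.
Proof.
have /andP[/injectiveP injI /and3P[/eqP cov /trivIsetP tri ne0]] := valP I.
have /fin_all_exists[g gP] i : exists k, i \in val I k.
  have : i \in cover [set val I k | k : 'I_#|B|] by rewrite cov inE.
  by case/bigcupP => _ /imsetP[k _ ->] iI; exists k.
(* Injectivity of the indexing is needed here: distinct indices give distinct, hence disjoint,
   blocks. *)
have g_uniq i k : i \in val I k -> g i = k.
  move=> iI; apply/eqP; apply: contraTT iI => ne.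
  have dis : [disjoint val I (g i) & val I k].
    by apply: tri; rewrite ?imset_f // (inj_eq injI).
  by rewrite (disjointFr dis).
pose w := [tuple letter (g i) | i < n].
have full : alph w == [set: B].
  apply/eqP/setP => b; rewrite !inE; apply/tnthP.
  have /set0Pn[i iI] : val I (Order.enum_rank b) != set0.
    by apply: contraNneq ne0 => <-; apply: imset_f.
  by exists i; rewrite tnth_mktuple (g_uniq _ _ iI) letter_rank.
exists (Sub w full); apply/val_inj/ffunP => k; apply/setP => i.
rewrite [LHS](mem_tabloid (Sub w full)) SubK tnth_mktuple (inj_eq letter_inj).
by apply/eqP/idP => [<-|/g_uniq].
Qed.

(** Matches the multiplicities defining [in_Wlambda] with the block sizes defining [in_Tlambda]. *)
Lemma card_tabloid w k : #|tabloid w k| = count_mem (letter k) (val w).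
Proof.
have -> : count_mem (letter k) (val w)
          = count (fun i => tnth (val w) i == letter k) (enum 'I_n).
  by rewrite -[tval (val w)]map_tnth_enum count_map.
rewrite -sum1_card -sum1_count big_enum_cond.
by apply: eq_bigl => i; rewrite mem_tabloid.
Qed.

(** The letter of [v] at [i] is that of [w] at [s i], so [i] lies in a block of [v] exactly when
    [s i] lies in the same block of [w]. *)
Lemma tabloid_place w v s :
  val v = place (val w) s -> tabloid v = osp_act s^-1%g (tabloid w).
Proof.
move=> e; apply/val_inj/ffunP => k; apply/setP => i.
rewrite [RHS](_ : _ = (i \in s^-1%g @: tabloid w k)); last by rewrite /= !ffunE.
rewrite [LHS](mem_tabloid v) e tnth_mktuple -[i in RHS](permK s).
by rewrite mem_imset ?mem_tabloid //; apply: perm_inj.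
Qed.

Lemma full_place w s : alph (place (val w) s) == [set: B].
Proof.
apply/eqP; rewrite -[RHS](eqP (valP w)); apply/setP => b; rewrite !inE.
exact: perm_mem (perm_place _ _) _.
Qed.

Lemma mcoeff_tabloid_map P w :
  (tabloid_map n P)@_(tabloid w) = P@_(FMonom (val w)).
Proof.
rewrite mcoeff_sumU (big_pred1 w) // => v.
by rewrite (inj_eq tabloid_inj).
Qed.

Lemma tabloid_map_linear : linear (@tabloid_map K d B n).
Proof.
move=> a P Q; apply/malgP => I; have [w <-] := tabloid_surj I.
by rewrite mcoeff_tabloid_map !(mcoeffD, mcoeffZ) -!mcoeff_tabloid_map.
Qed.

HB.instance Definition _ :=
  GRing.isLinear.Build K _ _ _ (@tabloid_map K d B n) tabloid_map_linear.

Lemma tabloid_map_circ s P :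
  tabloid_map n (circ s P) = tabact s (tabloid_map n P).
Proof.
apply/malgP => I; have [w <-] := tabloid_surj I.
rewrite mcoeff_tabact mcoeff_tabloid_map mcoeff_polyact invgK.
pose v : full_word B n := Sub (place (val w) s) (full_place w s).
by rewrite -(@tabloid_place w v) // mcoeff_tabloid_map.
Qed.

Lemma tabloid_map_circK (c : {malg K['S_n]}) P :
  tabloid_map n (circK c P) = tabactK c (tabloid_map n P).
Proof.
by rewrite linear_sum; apply: eq_bigr => s _; rewrite linearZ /= tabloid_map_circ.
Qed.

(** Serves both isomorphisms, for all full words and for a fixed content. Keeping [N] apart from
    [Kspan S'] allows the codomain to be given as the whole module. *)
Lemma tabloid_map_iso (S : pred {fmonom B}) (S' : pred (osp n #|B|))
    (N : {malg K[osp n #|B|]} -> Prop) :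
  (forall u v : {fmonom B}, perm_eq u v -> S u -> S v) ->
  (forall u : {fmonom B}, S u -> size u = n /\ alph u = [set: B]) ->
  (forall w, S' (tabloid w) = S (FMonom (val w))) ->
  (forall T, N T <-> Kspan S' T) ->
  module_iso_on (@circK K B n) (@tabactK K n #|B|) (Kspan S) N
    (@tabloid_map K d B n).
Proof.
move=> S_perm S_full S'E NE.
have maps P : Kspan S P -> N (tabloid_map n P).
  move/KspanP => SP; apply/NE/KspanP => I; have [w <-] := tabloid_surj I.
  by rewrite mcoeff_tabloid_map S'E => /SP.
have surj T : N T -> exists2 P, Kspan S P & tabloid_map n P = T.
  move=> /NE/KspanP ST.
  pose P : {malg K[{fmonom B}]} :=
    \sum_(w : full_word B n) T@_(tabloid w) *: << FMonom (val w) >>.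
  have PE w : P@_(FMonom (val w)) = T@_(tabloid w).
    by rewrite mcoeff_sumU (big_pred1 w).
  exists P; last first.
    apply/malgP => I; have [w <-] := tabloid_surj I.
    by rewrite mcoeff_tabloid_map PE.
  apply/KspanP => u nz; have [w] := mcoeff_sum_neq0 nz.
  rewrite mcoeffU; case: (_ =P u) => [e _|_]; last by rewrite eqxx.
  by rewrite -e -S'E; apply: ST; rewrite -PE e.
split.
- by move=> c P; apply: circK_stable.
(* Stability of the codomain is transported from the domain through surjectivity and
   equivariance. *)
- move=> c T /surj[P SP <-]; rewrite -tabloid_map_circK.
  by apply/maps/circK_stable.
- by move=> a P Q _ _; apply: linearP.
- exact: maps.
- move=> P Q /KspanP SP /KspanP SQ e; apply/malgP => u.
  (* Outside [S] both coefficients vanish; inside, [u] is a full word, whose coefficient is visible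
     in the image. *)
  have [Su|nSu] := boolP (S u); last first.
    have zero R : (forall x, R@_x != 0 -> S x) -> R@_u = 0 :> K.
      by move=> SR; apply/eqP; apply: contraNT nSu => /SR.
    by rewrite !zero.
  have [/eqP sz /eqP full] := S_full u Su.
  have uE : u = FMonom (val (Sub (Tuple sz) full : full_word B n)).
    by apply/val_inj; rewrite SubK.
  by rewrite uE -!mcoeff_tabloid_map e.
- exact: surj.
- by move=> c P _; apply: tabloid_map_circK.
Qed.

End Tabloid.

(** * The bracketing element and its adjoint *)

Lemma lie_adj_eltV (K : comNzRingType) n (s : 'S_n) :
  (lie_adj_elt K n)@_s = (lie_elt K n)@_(s^-1)%g.
Proof.
have placeE (t : 'S_n) : place (ord_tuple n) t = map t (ord_tuple n) :> seq _.
  by apply: eq_map => i; rewrite tnth_ord_tuple.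
rewrite !mcoeff_sumU (big_pred1 s) // (big_pred1 s^-1%g) // mcoeff_lie_adj.
(* Renaming along [s] on the right-hand side turns the identity word into the word of [s], and the
   word of [s^-1] into the identity word. *)
rewrite placeE -(@mcoeff_lie_map K _ _ s (@perm_inj _ s) _ (place _ _)).
congr (_@_(FMonom _)); rewrite placeE -map_comp -[LHS]map_id.
by apply: eq_map => i /=; rewrite permKV.
Qed.

(** The inversion relating the two coefficient families cancels the one in the definition of
    [circ]. *)
Lemma polyactK_lie_adj_elt (K : comNzRingType) (X : finType) n
    (P : {malg K[{fmonom X}]}) :
  polyactK P (lie_adj_elt K n) = circK (lie_elt K n) P.
Proof.
rewrite /circK (reindex_inj invg_inj); apply: eq_bigr => s _.
by rewrite lie_adj_eltV /circ invgK.
Qed.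

(** Places words of content [lam] inside $W_n^r$: the parts sum to [n], which fixes the length, and
    are positive, so each letter occurs. *)
Lemma is_partition_alph d (B : finOrderType d) n (lam : #|B|.-tuple nat)
    (u : seq B) :
  is_partition n lam ->
  (forall k, count_mem (letter k) u = tnth lam k) ->
  size u = n /\ alph u = [set: B].
Proof.
move=> /and3P[_ /all_tnthP lam_gt0 /eqP lam_n] cnt; split.
  rewrite -sum1_size (partition_big (@Order.enum_rank _ B) predT) //=.
  rewrite -lam_n sumnE big_tuple; apply: eq_bigr => k _.
  rewrite -cnt -sum1_count; apply: eq_bigl => b.
  by rewrite -(inj_eq (@letter_inj _ B)) letter_rank.
apply/setP => b; rewrite !inE -has_pred1 has_count -[b]letter_rank cnt.
exact: lam_gt0.
Qed.

Theorem theorem4p3 (K : comNzRingType) (d : Order.disp_t) (B : finOrderType d)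
    (n : nat) (n_ge1 : (1 <= n)%N) :
  let f := @tabloid_map K d B n in
  [/\ linear f /\ (forall w : full_word B n, f (wordp K (val w)) = << tabloid w >>),
      module_iso_on (@circK K B n) (@tabactK K n #|B|)
        (@in_W K d B n) (fun _ => True) f,
      forall (s : 'S_n) (P : {malg K[{fmonom B}]}), in_W n P ->
        f (circ s P) = tabact s (f P),
      forall lam : #|B|.-tuple nat, is_partition n lam ->
        module_iso_on (@circK K B n) (@tabactK K n #|B|)
          (@in_Wlambda K d B lam) (@in_Tlambda K n #|B| lam) f
    & forall w : full_word B n,
        f (polyactK (wordp K (val w)) (lie_adj_elt K n)) =
        tabactK (lie_elt K n) << tabloid w >>].
Proof.
move=> f; split.
- split; [exact: tabloid_map_linear | exact: tabloid_map_word].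
- apply: (@tabloid_map_iso _ _ _ _ _ predT) => //.
  + move=> u v p /= /andP[/eqP sz /eqP full]; rewrite -(perm_size p) sz eqxx /=.
    by rewrite -full; apply/eqP/setP => b; rewrite !inE (perm_mem p).
  + by move=> u /= /andP[/eqP ? /eqP ?].
  + by move=> w /=; rewrite size_tuple eqxx (valP w).
  + by move=> T; split=> // _; apply/KspanP.
- by move=> s P _; apply: tabloid_map_circ.
- move=> lam lamP.
  apply: (@tabloid_map_iso _ _ _ _ _
    [pred I : osp n #|B| | [forall k, #|I k| == tnth lam k]]) => //.
  + move=> u v /seq.permP p /= /forallP cnt; apply/forallP => k.
    by rewrite -p.
  + move=> u /= /forallP cnt; apply: is_partition_alph lamP _ => k.
    exact/eqP.
  + by move=> w /=; apply: eq_forallb => k; rewrite -card_tabloid.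
(* Writing the tabloid as the image of [w] lets equivariance move [lie_elt] inside [f]. *)
- move=> w; rewrite -(tabloid_map_word K w) -(tabloid_map_circK (lie_elt K n)).
  by rewrite polyactK_lie_adj_elt.
Qed.
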